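(* Let $(M_t,d_t)_{t\in\mathbb{R}}$ be a one-parameter family of complete metric spaces (possibly in the extended sense) and let $(\mu_{st})_{s,t\in\mathbb{R}}$ be a local approximate flow associated with it, with data $f$, $\varepsilon$, $n$, $(a_i,b_i,C_i)_{1\le i\le n}$ and $g$ as in the context. Then there exists a unique local flow $(\varphi_{st})$ such that $$d_{st}(\varphi_{st},\mu_{st})\le C'|t-s|^{1+\varepsilon},$$ which is obtained as the limit in $C_{st}$ of the compositions $$\mu_{st_1}\circ\mu_{t_1t_2}\circ\cdots\circ\mu_{t_{k-1}t}$$ when the mesh of the subdivision $(s,t_1,\ldots,t_{k-1},t)$ of the interval between $s$ and $t$ tends to zero. One possible constant $C'$ is given by $$C'=2^{1+\varepsilon}g(|t-s|)\left(\sum_{i=1}^n C_i\right)\zeta(1+\varepsilon),$$ where $\zeta$ is the Riemann zeta function. Moreover, the local flow $(\varphi_{st})$ satisfies the Lipschitz condition $$\operatorname{Lip}(\varphi_{st})\le g(|t-s|).$$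
   Context: An extended metric space is a set with a distance taking values in $[0,+\infty]$ (value $+\infty$ allowed) satisfying the usual axioms of a distance; completeness is defined via Cauchy sequences as usual. For a map $h:X\to Y$ between (extended) metric spaces, $\operatorname{Lip}(h)=\sup_{x'\ne x''} d_Y(h(x'),h(x''))/d_X(x',x'')\in[0,+\infty]$. Let $(M_t,d_t)_{t\in\mathbb{R}}$ be a family of complete metric spaces, possibly in the extended sense. $C_{st}$ denotes the set of continuous maps from $M_t$ to $M_s$, endowed with the (extended) distance $d_{st}(h,h')=\sup_{x\in M_t} d_s(h(x),h'(x))$. A local flow associated with $(M_t,d_t)_{t\in\mathbb R}$ is a family $(\varphi_{st})_{s,t\in\mathbb{R}}$ with $\varphi_{st}\in C_{st}$, $\varphi_{ss}=\mathrm{Id}_{M_s}$ for all $s$, and $\varphi_{st}=\varphi_{su}\circ\varphi_{ut}$ for all $s,t,u\in\mathbb{R}$. A local approximate flow associated with $(M_t,d_t)_{t\in\mathbb R}$ is a family $(\mu_{st})_{s,t\in\mathbb{R}}$ such that: (1) $\mu_{st}\in C_{st}$; (2) $\mu_{ss}=\mathrm{Id}_{M_s}$ for all $s$; (3) there is a continuous function $f:\mathbb{R}\to[0,+\infty[$ with $f(0)=0$ and $\operatorname{Lip}(\mu_{st})\le 1+f(t-s)$; (4) there are $\varepsilon>0$, an integer $n\ge1$, positive constants $a_i,b_i$ ($i=1,\ldots,n$) with $a_i+b_i=1+\varepsilon$, and constants $C_i$ ($i=1,\ldots,n$), such that for all $s,t,u\in\mathbb{R}$, $d_{st}(\mu_{st},\mu_{su}\circ\mu_{ut})\le\sum_{i=1}^n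 C_i|t-u|^{a_i}|u-s|^{b_i}$; (5) there is a non-decreasing continuous function $g:[0,+\infty[\to[1,+\infty[$ such that for all $s,t\in\mathbb{R}$ and any finite collection $I=(t_0,\ldots,t_k)$ of reals with $t_0=s$, $t_k=t$, the map $\mu_{st}^I:=\mu_{t_0t_1}\circ\mu_{t_1t_2}\circ\cdots\circ\mu_{t_{k-1}t_k}$ satisfies $\operatorname{Lip}(\mu^I_{st})\le g\big(\sum_{j=1}^k|t_j-t_{j-1}|\big)$. A subdivision of the interval between $s$ and $t$ is a finite sequence $(t_0,\ldots,t_k)$ with $t_0=s$, $t_k=t$, arranged in increasing or decreasing order according to the sign of $t-s$; its mesh is $\sup_{1\le j\le k}|t_j-t_{j-1}|$. *)

(* Defs.v *)
From mathcomp Require Import all_boot all_order all_algebra.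
From mathcomp Require Import all_classical all_reals all_analysis.
Import Order.TTheory GRing.Theory Num.Theory.
Import numFieldNormedType.Exports.

Set Implicit Arguments.
Unset Strict Implicit.
Unset Printing Implicit Defensive.

Local Open Scope classical_set_scope.
Local Open Scope ring_scope.

(* The distance of an extended metric space is the library's [edist], with     *)
(* values in \bar R, of a [pseudoMetricType R]: [edist] is symmetric,          *)
(* satisfies the triangle inequality, vanishes on the diagonal and induces the *)
(* topology. The only missing axiom is the separation of points. Conversely,   *)
(* any extended distance is the [edist] of its open balls.                     *)
Definition ext_metric (R : realType) (T : pseudoMetricType R) : Prop :=
  forall x y : T, edist (x, y) = 0%E -> x = y.

(* The library's [completeType] would exclude the empty space. *)
Definition seq_complete (R : realType) (T : pseudoMetricType R) : Prop :=
  forall u : nat -> T, cauchy (u @ \oo) -> exists l : T, u @ \oo --> l.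

(* In both definitions the supremum is taken in [0, +oo], whence the added 0.  *)
(* In [Lip], a quotient by an infinite distance is 0 since +oo^-1 = 0 and      *)
(* x * 0 = 0 in \bar R, even for x = +oo.                                      *)
Definition supdist (R : realType) (X : Type) (Y : pseudoMetricType R)
    (h h' : X -> Y) : \bar R :=
  ereal_sup (0%E |` [set edist (h x, h' x) | x in [set: X]]).

Definition Lip (R : realType) (X Y : pseudoMetricType R) (h : X -> Y) : \bar R :=
  ereal_sup (0%E |`
    [set (edist (h z.1, h z.2) / edist (z.1, z.2))%E
      | z in [set z : X * X | z.1 <> z.2]]).

Definition zeta (R : realType) (x : R) : R := limn (series (riemannR x)).

Section Flows.
Context {R : realType} (M : R -> pseudoMetricType R).
Implicit Types (mu phi : forall s t : R, M t -> M s) (s t u : R) (p : seq R).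

(* A finite collection (t_0, ..., t_k) with t_0 = s, t_k = t and k >= 1 is     *)
(* given by s, the sequence p of its inner points t_1, ..., t_(k-1), and t.    *)
Fixpoint compose_along mu s p t : M t -> M s :=
  if p is u :: p' then mu s u \o @compose_along mu u p' t else mu s t.
Arguments compose_along : clear implicits.

Definition steps s p t : seq R := pairmap (fun x y => `|y - x|) s (rcons p t).

Definition total_length s p t : R := \sum_(d <- steps s p t) d.

Definition mesh s p t : R := \big[Num.max/0]_(d <- steps s p t) d.

(* Points may be repeated; mu_(uu) = Id makes repetitions immaterial. *)
Definition subdivision s p t : bool :=
  sorted (if s <= t then <=%R else >=%R) (s :: rcons p t).

Record local_flow phi : Prop := LocalFlow {
  flow_continuous : forall s t, continuous (phi s t);
  flow_id : forall s, phi s s = id;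
  flow_comp : forall s t u, phi s t = phi s u \o phi u t
}.

Record local_approximate_flow mu (f : R -> R) (eps : R) (n : nat)
    (a b C : 'I_n -> R) (g : R -> R) : Prop := LocalApproximateFlow {
  aflow_continuous : forall s t, continuous (mu s t);
  aflow_id : forall s, mu s s = id;
  aflow_f_continuous : continuous f;
  aflow_f_ge0 : forall x : R, 0 <= f x;
  aflow_f0 : f 0 = 0;
  aflow_Lip : forall s t, (Lip (mu s t) <= (1 + f (t - s))%:E)%E;
  aflow_eps : 0 < eps;
  aflow_n : (1 <= n)%N;
  aflow_ab : forall i, [/\ 0 < a i, 0 < b i & a i + b i = 1 + eps];
  aflow_comp : forall s t u,
    (supdist (mu s t) (mu s u \o mu u t)
       <= (\sum_(i < n) C i * `|t - u| `^ a i * `|u - s| `^ b i)%:E)%E;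
  aflow_g_continuous : {within `[0, +oo[, continuous g};
  aflow_g_homo : forall x y : R, 0 <= x -> x <= y -> g x <= g y;
  aflow_g_ge1 : forall x : R, 0 <= x -> 1 <= g x;
  aflow_Lip_along : forall s p t,
    (Lip (compose_along mu s p t) <= (g (total_length s p t))%:E)%E
}.

(* phi_st is the limit in C_st of the compositions of mu along the             *)
(* subdivisions between s and t, as the mesh tends to 0.                       *)
Definition limit_of_compositions mu phi : Prop :=
  forall s t (e : R), 0 < e -> exists2 delta : R, 0 < delta &
    forall p, subdivision s p t -> mesh s p t < delta ->
      (supdist (compose_along mu s p t) (phi s t) < e%:E)%E.

(* d_st(phi_st, mu_st) <= C' |t - s|^(1 + eps), where C' may depend on an      *)
(* upper bound of |t - s|, like g(|t - s|) does, but not on s and t otherwise. *)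
Definition close_to_order mu (eps : R) phi : Prop :=
  forall T : R, exists C' : R, forall s t, `|t - s| <= T ->
    (supdist (phi s t) (mu s t) <= (C' * `|t - s| `^ (1 + eps))%:E)%E.

End Flows.

Arguments compose_along {R M} mu s p t.

(* Main.v *)
Require Import Defs.
From mathcomp Require Import all_boot all_order all_algebra.
From mathcomp Require Import all_classical all_reals all_analysis.
From mathcomp Require Import ring lra.
Set Implicit Arguments.
Unset Strict Implicit.
Unset Printing Implicit Defensive.

Import Order.TTheory GRing.Theory Num.Theory.
Import numFieldNormedType.Exports.

Local Open Scope classical_set_scope.
Local Open Scope ring_scope.

(** The flow is built by sewing the maps [mu] along finer and finer
    subdivisions. Two facts make this work. First, inserting a point in a step
    of length [h] changes [mu] by at most a constant times [h ^ (1 + eps)], so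
    that changing all the steps of a subdivision of mesh [h] costs a quantity of
    order [h ^ eps]. Second, such a change, made one step at a time from the
    right, is only distorted by the factors on its left, and these are
    compositions of [mu] along a sequence of bounded length, which expand
    distances by at most [g]: the distortions do not accumulate. This is
    [compose_along_uclose].

    Existence. Halving every step of the subdivision of the interval between [s]
    and [t] into [2 ^ n] equal parts costs at most
    [g (|t - s|) * (C_1 + ... + C_n) * |t - s| ^ (1 + eps)] times the block of the
    series of [zeta (1 + eps)] from the rank [2 ^ n] to the rank [2 ^ n.+1]
    ([dyadic_step]). The dyadic compositions thus converge to maps [phi], at a
    distance from [mu] bounded by the whole series. The constants [C_i] may be
    negative, and it is only at midpoints that their sum bounds the defect of
    [mu]; this is why the explicit constant comes from halving.

    Flow property. The compositions along the subdivisions into [N] equal parts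
    also tend to [phi] ([uniform_limit_close]). For [u] between [s] and [t],
    subdivide the interval between [s] and [u] into [m] parts, and the one
    between [u] and [t] into [l] parts of nearly the same length: the sequence
    obtained keeps within one step of the uniform subdivision into [m + l] parts,
    so that the two compositions are close ([ladder_close]) and
    [phi s t = phi s u \o phi u t] in the limit. Going forth and back along the
    same sequence collapses from the turning point ([run_back_close]), so that
    [phi s u] and [phi u s] are inverse to each other, and the flow property for
    other positions of [u] follows by composing with inverses.

    Limit and uniqueness. A flow is its own composition along every subdivision.
    If it is close to [mu] up to the order [1 + eps], then exchanging [mu] for the
    flow in all the steps of a subdivision shows that the compositions of [mu]
    tend to the flow as the mesh tends to 0. In particular, two such flows are
    equal. *)

(** * Extended distances, uniform closeness and Lipschitz maps *)

Section Closeness.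
Context {R : realType}.
Implicit Types X Y Z : pseudoMetricType R.

Lemma edist_trans Y (x y z : Y) (c d : R) :
  (edist (x, y) <= c%:E)%E -> (edist (y, z) <= d%:E)%E ->
  (edist (x, z) <= (c + d)%:E)%E.
Proof.
move=> xy yz; apply: (le_trans (edist_triangle x y z)).
by rewrite EFinD leeD.
Qed.

Lemma edist_bound_ge0 Y (x y : Y) (c : R) : (edist (x, y) <= c%:E)%E -> 0 <= c.
Proof. by move=> xy; rewrite -lee_fin (le_trans _ xy) ?edist_ge0. Qed.

Lemma edist_le_lim Y (x y : Y) (c : R) :
  (forall e, 0 < e -> (edist (x, y) <= (c + e)%:E)%E) ->
  (edist (x, y) <= c%:E)%E.
Proof. by move=> xy; apply/lee_addgt0Pr => e e0; rewrite -EFinD xy. Qed.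

(** The bound [supdist h h' <= c%:E], without the sign condition on [c] that
    the supremum carries; it makes sense for maps out of any type. *)
Definition uclose {A : Type} {Y} (c : R) (h h' : A -> Y) : Prop :=
  forall x, (edist (h x, h' x) <= c%:E)%E.

(** The form of [Lip h <= L%:E] that composes: no division, and nothing is
    asked of points at infinite distance. *)
Definition expands_by {X Y} (L : R) (h : X -> Y) : Prop :=
  forall x y c, (edist (x, y) <= c%:E)%E -> (edist (h x, h y) <= (L * c)%:E)%E.

Lemma uclose_supdist {A : Type} {Y} (c : R) (h h' : A -> Y) :
  0 <= c -> uclose c h h' -> (supdist h h' <= c%:E)%E.
Proof.
move=> c0 hh'; apply: ge_ereal_sup => _ [->|[x _ <-]]; last exact: hh'.
by rewrite lee_fin.
Qed.

Lemma supdist_uclose {A : Type} {Y} (c : R) (h h' : A -> Y) :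
  (supdist h h' <= c%:E)%E -> uclose c h h'.
Proof.
move=> hh' x; apply: le_trans hh'; apply: ereal_sup_ubound.
by right; exists x.
Qed.

Lemma supdist_ge0 {A : Type} {Y} (h h' : A -> Y) : (0 <= supdist h h')%E.
Proof. by apply: ereal_sup_ubound; left. Qed.

Lemma uclose_refl {A : Type} {Y} (h : A -> Y) : uclose 0 h h.
Proof. by move=> x; rewrite edist_refl. Qed.

Lemma uclose_sym {A : Type} {Y} (c : R) (h h' : A -> Y) :
  uclose c h h' -> uclose c h' h.
Proof. by move=> hh' x; rewrite edist_sym. Qed.

Lemma uclose_trans {A : Type} {Y} (c d : R) (h1 h2 h3 : A -> Y) :
  uclose c h1 h2 -> uclose d h2 h3 -> uclose (c + d) h1 h3.
Proof. by move=> h12 h23 x; apply: edist_trans (h12 x) (h23 x). Qed.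

Lemma uclose_le {A : Type} {Y} (c d : R) (h h' : A -> Y) :
  c <= d -> uclose c h h' -> uclose d h h'.
Proof. by move=> cd hh' x; apply: (le_trans (hh' x)); rewrite lee_fin. Qed.

Lemma uclose_comp {A B : Type} {Y} (c : R) (h h' : B -> Y) (k : A -> B) :
  uclose c h h' -> uclose c (h \o k) (h' \o k).
Proof. by move=> hh' x; apply: hh'. Qed.

Lemma expands_uclose {A : Type} {X Y} (L c : R) (k : X -> Y) (h h' : A -> X) :
  expands_by L k -> uclose c h h' -> uclose (L * c) (k \o h) (k \o h').
Proof. by move=> kL hh' x; apply: kL. Qed.

Lemma expands_continuous {X Y} (L : R) (h : X -> Y) :
  expands_by L h -> continuous h.
Proof.
move=> hL x; apply/cvg_ballP => e e0.
(* [edist] is only bounded weakly on balls, hence the factor 2. *)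
pose d := e / (2 * (`|L| + 1)).
have d0 : 0 < d by rewrite divr_gt0 // mulr_gt0 // ltr_wpDl.
near=> y; apply: (@edist_lt_ball _ _ e (h x, h y)).
have xy : (edist (x, y) <= d%:E)%E.
  by apply: edist_fin => //=; near: y; exact: nbhsx_ballx.
apply: (le_lt_trans (hL _ _ _ xy)); rewrite lte_fin.
apply: (@le_lt_trans _ _ ((`|L| + 1) * d)).
  by rewrite ler_wpM2r ?(ltW d0) // (le_trans (ler_norm _)) // lerDl.
have -> : (`|L| + 1) * d = e / 2.
  by rewrite /d; field; rewrite gt_eqF // ltr_wpDl.
by rewrite ltr_pdivrMr // ltr_pMr // ltr1n.
Unshelve. all: by end_near.
Qed.

Lemma Lip_expands {X Y} (X_metric : ext_metric X) (L : R) (h : X -> Y) :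
  (Lip h <= L%:E)%E -> expands_by L h.
Proof.
move=> hL x y c xy.
have L0 : 0 <= L.
  by rewrite -lee_fin (le_trans _ hL) //; apply: ereal_sup_ubound; left.
have c0 := edist_bound_ge0 xy.
have [->|/eqP xNy] := eqVneq x y.
  by rewrite edist_refl lee_fin mulr_ge0.
have : (edist (h x, h y) / edist (x, y) <= L%:E)%E.
  by apply: le_trans hL; apply: ereal_sup_ubound; right; exists (x, y).
have dN0 : edist (x, y) <> 0%E by move/X_metric.
have := edist_ge0 (x, y); move: xy dN0; case: (edist (x, y)) => [d| |] //=.
rewrite !lee_fin => dc dN0 d0.
have dp : 0 < d.
  by rewrite lt_neqAle d0 andbT eq_sym; apply/eqP => d00; apply: dN0; rewrite d00.
rewrite inver gt_eqF // lee_pdivrMr // => /le_trans; apply.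
by rewrite -EFinM lee_fin ler_wpM2l.
Qed.

Lemma expands_Lip {X Y} (X_metric : ext_metric X) (L : R) (h : X -> Y) :
  0 <= L -> expands_by L h -> (Lip h <= L%:E)%E.
Proof.
move=> L0 hL; apply: ge_ereal_sup => _ [->|[[x y] /= xNy <-]].
  by rewrite lee_fin.
have dN0 : edist (x, y) <> 0%E by move/X_metric.
have := edist_ge0 (x, y); have := hL x y; move: dN0.
case: (edist (x, y)) => [d| |] //=; last first.
  by move=> _ _ _; rewrite invey mule0 lee_fin.
move=> dN0 /(_ d (lexx _)) hd; rewrite lee_fin => d0.
have dp : 0 < d.
  by rewrite lt_neqAle d0 andbT eq_sym; apply/eqP => d00; apply: dN0; rewrite d00.
by rewrite inver gt_eqF // lee_pdivrMr // -EFinM.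
Qed.

Lemma uclose_eq {A : Type} {Y} (Y_metric : ext_metric Y) (h h' : A -> Y) :
  (forall e, 0 < e -> uclose e h h') -> h = h'.
Proof.
move=> hh'; apply: funext => x; apply: Y_metric; apply/eqP.
rewrite eq_le edist_ge0 andbT; apply: edist_le_lim => e e0.
by rewrite add0r; exact: hh'.
Qed.

Lemma complete_cvg_rate {Y} (Y_complete : seq_complete Y) (u : nat -> Y)
    (r : nat -> R) :
  (forall e, 0 < e -> exists n, r n < e) ->
  (forall n m, (n <= m)%N -> (edist (u n, u m) <= (r n)%:E)%E) ->
  exists l, forall n, (edist (u n, l) <= (r n)%:E)%E.
Proof.
move=> r0 ur.
have : cauchy (u @ \oo).
  apply: cauchy_exP => e /r0 [N rN]; exists (u N), N => // m Nm.
  apply: (@edist_lt_ball _ _ e (u N, u m)).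
  by apply: (le_lt_trans (ur _ _ Nm)); rewrite lte_fin.
move/Y_complete => [l ul]; exists l => n; apply: edist_le_lim => e e0.
have [m [nm lm]] : exists m, (n <= m)%N /\ ball l e (u m).
  move/cvg_ballP/(_ _ e0) : ul => [N _ Nl].
  by exists (maxn n N); split; [exact: leq_maxl|apply: Nl; exact: leq_maxr].
apply: (edist_trans (ur _ _ nm)); rewrite edist_sym.
by apply: edist_fin.
Qed.

End Closeness.

(** * The series of the zeta function, and the size of a uniform subdivision *)

Section Powers.
Context {R : realType}.
Implicit Types (e h : R) (n N : nat).

Lemma zeta_series_nondecreasing e (e_gt0 : 0 < e) :
  {homo series (riemannR (1 + e)) : n m / (n <= m)%N >-> n <= m}.
Proof.
move=> n m nm; rewrite -subr_ge0 sub_series_geq //.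
by apply: sumr_ge0 => k _; rewrite ltW // riemannR_gt0 // addr_ge0 // ltW.
Qed.

(** Each of the two terms of ranks [2n + 2] and [2n + 3] is at most
    [2 ^ - (1 + e)] times the term of rank [n + 1]; hence the partial sums [Z]
    satisfy [Z n <= Z (2 n + 1) <= 1 + 2 ^ - e * Z n]. *)
Lemma zeta_series_cvg e (e_gt0 : 0 < e) : cvgn (series (riemannR (1 + e))).
Proof.
have p0 : 0 <= 1 + e by rewrite addr_ge0 // ltW.
pose q : R := 2 * (2 `^ (1 + e))^-1.
have q1 : q < 1.
  rewrite /q powRD; last by rewrite pnatr_eq0 implybT.
  rewrite powRr1 // invfM mulrA divff // mul1r invf_lt1 ?powR_gt0 //.
  apply: (@le_lt_trans _ _ (1 `^ e)); first by rewrite powR1.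
  by rewrite gt0_ltr_powR ?nnegrE // ltr1n.
(* [series u n] sums the terms of indices below [n], and the index [i] stands
   for the rank [i + 1]. *)
have step n : series (riemannR (1 + e)) n.*2.+1 <=
    1 + q * series (riemannR (1 + e)) n.
  elim: n => [|n IHn].
    by rewrite /series /= big_nat1 big_geq // mulr0 addr0 /riemannR powR1 invr1.
  rewrite doubleS (seriesSr _ n.*2.+2) (seriesSr _ n.*2.+1) (seriesSr _ n).
  rewrite mulrDr addrA -[leLHS]addrA lerD // /riemannR.
  have -> : q * (n.+1%:R `^ (1 + e))^-1 =
      2 * (n.*2.+2%:R `^ (1 + e))^-1.
    rewrite /q -doubleS -muln2 natrM powRM // invfM; ring.
  rewrite mulr2n mulrDl mul1r lerD2l lef_pV2 ?posrE ?powR_gt0 //.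
  by rewrite ge0_ler_powR ?nnegrE // ler_nat.
apply: nondecreasing_is_cvgn; first exact: zeta_series_nondecreasing.
exists (1 / (1 - q)) => _ [n _ <-].
rewrite ler_pdivlMr ?subr_gt0 // mulrBr mulr1 lerBlDr.
rewrite [_ * q]mulrC (le_trans _ (step n)) //.
by apply: zeta_series_nondecreasing => //; rewrite -addnn -addnS leq_addr.
Qed.

Lemma le_zeta e (e_gt0 : 0 < e) n : series (riemannR (1 + e)) n <= zeta (1 + e).
Proof.
by apply: nondecreasing_cvgn_le;
  [exact: zeta_series_nondecreasing|exact: zeta_series_cvg].
Qed.

Lemma zeta_tail e (e_gt0 : 0 < e) d : 0 < d ->
  exists n, forall m, (n <= m)%N ->
    zeta (1 + e) - series (riemannR (1 + e)) m < d.
Proof.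
move=> d0; have /cvgrPdist_lt/(_ _ d0) [n _ nd] := zeta_series_cvg e_gt0.
by exists n => m nm; apply: (le_lt_trans (ler_norm _)); exact: nd.
Qed.

(** None of the [N] terms of ranks [N + 1], ..., [2 N] is smaller than the one
    of rank [2 N]. *)
Lemma zeta_block e (e_gt0 : 0 < e) N :
  N%:R * (N.*2%:R `^ (1 + e))^-1 <=
    series (riemannR (1 + e)) N.*2 - series (riemannR (1 + e)) N.
Proof.
rewrite sub_double_series -[X in X%:R * _](_ : (N.*2 - N)%N = _); last first.
  by rewrite -addnn addnK.
rewrite mulrC mulr_natr -sumr_const_nat big_nat_cond [leRHS]big_nat_cond.
apply: ler_sum => k /andP[/andP[_ kN] _].
rewrite /riemannR lef_pV2 ?posrE ?powR_gt0 //; last first.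
  by rewrite ltr0n (leq_ltn_trans _ kN).
by rewrite ge0_ler_powR ?nnegrE // ?ler_nat // addr_ge0 // ltW.
Qed.

(** [N * (h / N) ^ (1 + e)] is [h ^ (1 + e) * N ^ - e]. *)
Lemma uniform_sum_small e (e_gt0 : 0 < e) h : 0 <= h -> forall c d, 0 <= c ->
  0 < d -> exists n, forall N, (n < N)%N ->
    c * (N%:R * (h / N%:R) `^ (1 + e)) < d.
Proof.
move=> h0 c d c0 d0.
have e0 := ltW e_gt0.
have p0 : 0 <= 1 + e by rewrite addr_ge0.
pose A := (c * h `^ (1 + e)) / d.
have A0 : 0 <= A by rewrite divr_ge0 ?mulr_ge0 ?powR_ge0 // ltW.
exists (Num.truncn (A `^ e^-1)) => N; rewrite truncn_lt_nat ?powR_ge0 // => AN.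
have N0 : 0 < N%:R :> R by rewrite (le_lt_trans _ AN) // powR_ge0.
have : (A `^ e^-1) `^ e < N%:R `^ e by rewrite gt0_ltr_powR ?nnegrE ?powR_ge0 ?ltW.
rewrite -powRrM mulVf ?gt_eqF // powRr1 // /A ltr_pdivrMr // => small.
have -> : N%:R * (h / N%:R) `^ (1 + e) = h `^ (1 + e) / N%:R `^ e.
  rewrite powRM ?invr_ge0 ?(ltW N0) // mulrCA; congr (_ * _).
  rewrite -powR_inv1 ?(ltW N0) // -powRrM mulN1r powRN.
  rewrite powRD ?(gt_eqF N0) ?implybT // powRr1 ?(ltW N0) //.
  by rewrite invfM mulrA divff ?mul1r // gt_eqF.
by rewrite mulrA ltr_pdivrMr ?powR_gt0 // [d * _]mulrC.
Qed.

End Powers.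

(** * Compositions along sequences and uniform subdivisions *)

(** The first point [x] is listed and the end [x + n h] is not, so that
    consecutive runs concatenate. Since [mu x x = id], listing [x] does not
    change the compositions of [mu] that start from [x]. *)
Definition run {R : realType} (x h : R) (n : nat) : seq R :=
  mkseq (fun i => x + h *+ i) n.

Section Compositions.
Context {R : realType} {M : R -> pseudoMetricType R}.
Implicit Types (mu nu : forall s t : R, M t -> M s) (s t u x y h : R).
Implicit Types (p q : seq R) (e : R -> R) (m n : nat).

Lemma run_rcons x h n : run x h n.+1 = rcons (run x h n) (x + h *+ n).
Proof. exact: mkseqS. Qed.

Lemma run_cat x h m n : run x h (m + n) = run x h m ++ run (x + h *+ m) h n.
Proof.
elim: n => [|n IHn]; first by rewrite addn0 cats0.
by rewrite addnS !run_rcons IHn -rcons_cat mulrnDr addrA.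
Qed.

Lemma run_cons x h n : run x h n.+1 = x :: run (x + h) h n.
Proof. by rewrite -add1n run_cat /= addr0. Qed.

Lemma compose_along_cat mu s p u q t :
  compose_along mu s (p ++ u :: q) t =
  compose_along mu s p u \o compose_along mu u q t.
Proof. by elim: p s => [|v p IHp] s //=; rewrite IHp. Qed.

Lemma compose_along_rcons mu s p u t :
  compose_along mu s (rcons p u) t = compose_along mu s p u \o mu u t.
Proof. by rewrite -cats1 compose_along_cat. Qed.

Lemma sum_steps_rcons e s p u t :
  \sum_(d <- steps s (rcons p u) t) e d =
  \sum_(d <- steps s p u) e d + e `|t - u|.
Proof.
by rewrite /steps -[rcons (rcons _ _) _]cats1 pairmap_cat last_rcons big_cat
  big_seq1.
Qed.

Lemma total_length_rcons s p u t :
  total_length s (rcons p u) t = total_length s p u + `|t - u|.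
Proof. exact: sum_steps_rcons. Qed.

Lemma total_length_nil s t : total_length s [::] t = `|t - s|.
Proof. by rewrite /total_length /steps big_seq1. Qed.

Lemma total_length_ge0 s p t : 0 <= total_length s p t.
Proof.
elim/last_ind: p t => [|p u IHp] t; first by rewrite total_length_nil.
by rewrite total_length_rcons addr_ge0.
Qed.

Lemma sum_steps_run e s p x h n t : t = x + h *+ n ->
  \sum_(d <- steps s (p ++ run x h n) t) e d =
  \sum_(d <- steps s p x) e d + e `|h| *+ n.
Proof.
move=> ->; elim: n => [|n IHn]; first by rewrite cats0 !mulr0n !addr0.
rewrite run_rcons -rcons_cat sum_steps_rcons IHn [in RHS]mulrSr addrA.
by congr (_ + e `|_|); rewrite mulrSr; ring.
Qed.

Lemma total_length_run s p x h n t : t = x + h *+ n ->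
  total_length s (p ++ run x h n) t = total_length s p x + `|h| *+ n.
Proof. exact: (sum_steps_run id). Qed.

Lemma uniform_end s t n : (0 < n)%N -> t = s + (t - s) / n%:R *+ n.
Proof.
by move=> n0; rewrite -[X in _ + X]mulr_natr mulfVK ?pnatr_eq0 -?lt0n // addrC subrK.
Qed.

Lemma uniform_length s t n : (0 < n)%N ->
  total_length s (run s ((t - s) / n%:R) n) t = `|t - s|.
Proof.
move=> n0; rewrite (total_length_run s [::] (uniform_end s t n0)).
rewrite total_length_nil subrr normr0 add0r normrM normfV normr_nat.
by rewrite -[LHS]mulr_natr mulfVK // pnatr_eq0 -lt0n.
Qed.

Lemma steps_ge0 s p t d : d \in steps s p t -> 0 <= d.
Proof.
elim: p s => [|u p IHp] s; rewrite /steps /= inE.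
  by move=> /eqP ->.
by case/orP=> [/eqP -> //|]; exact: IHp.
Qed.

Lemma sum_steps_mesh (eps : R) s p t : 0 < eps ->
  \sum_(d <- steps s p t) d `^ (1 + eps) <=
  mesh s p t `^ eps * total_length s p t.
Proof.
move=> eps_gt0; rewrite /total_length mulr_sumr big_seq [leRHS]big_seq.
apply: ler_sum => d dp; have d0 := steps_ge0 dp.
have dm : d <= mesh s p t by exact: (@le_bigmax_seq _ _ _ _ _ d predT id dp).
have order_neq0 : (1 + eps == 0) = false by rewrite gt_eqF // addr_gt0.
rewrite powRD ?order_neq0 // powRr1 // mulrC ler_wpM2r //.
by rewrite ge0_ler_powR ?nnegrE ?(le_trans d0 dm) // ltW.
Qed.

Lemma subdivision_length s p t :
  subdivision s p t -> total_length s p t = `|t - s|.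
Proof.
rewrite /subdivision /total_length /steps; case: (leP s t) => [st|ts] /=.
  rewrite ger0_norm ?subr_ge0 //.
  elim: p s {st} => [|u p IHp] s /=.
    by rewrite andbT big_seq1 => st; rewrite ger0_norm ?subr_ge0.
  by move=> /andP[su up]; rewrite big_cons IHp // ger0_norm ?subr_ge0 //; ring.
rewrite ltr0_norm ?subr_lt0 //.
elim: p s {ts} => [|u p IHp] s /=.
  by rewrite andbT big_seq1 => st; rewrite ler0_norm ?subr_le0.
by move=> /andP[su up]; rewrite big_cons IHp // ler0_norm ?subr_le0 //; ring.
Qed.

(** Replace the factors [mu x y] by [nu x y] one at a time, from the right: the
    factors [mu] that remain on the left form a composition along a prefix,
    which expands distances by [G], however many they are. *)
Lemma compose_along_uclose mu nu (T G : R) e :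
  1 <= G -> (forall d, 0 <= e d) ->
  (forall s p t, total_length s p t <= T ->
     expands_by G (compose_along mu s p t)) ->
  (forall x y, `|y - x| <= T -> uclose (e `|y - x|) (mu x y) (nu x y)) ->
  forall s p t, total_length s p t <= T ->
    uclose (G * \sum_(d <- steps s p t) e d)
      (compose_along mu s p t) (compose_along nu s p t).
Proof.
move=> G1 e0 muG munu s p.
elim/last_ind: p => [|p u IHp] t.
  rewrite total_length_nil /steps big_seq1 /= => /munu.
  by apply: uclose_le; rewrite ler_peMl.
rewrite total_length_rcons sum_steps_rcons !compose_along_rcons => lT.
have luT : total_length s p u <= T by apply: le_trans lT; rewrite lerDl.
have duT : `|t - u| <= T.
  by apply: le_trans lT; rewrite lerDr total_length_ge0.
rewrite mulrDr addrC; apply: uclose_trans.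
  exact: expands_uclose (muG _ _ _ luT) (munu _ _ duT).
exact: uclose_comp (IHp _ luT).
Qed.

Section Unital.
Context {mu} (mu_id : forall s, mu s s = id).

Lemma compose_along_run s p x h n t : t = x + h *+ n ->
  compose_along mu s (p ++ run x h n) t =
  compose_along mu s p x \o compose_along mu x (run x h n) t.
Proof.
case: n => [|n] tE.
  by rewrite mulr0n addr0 in tE; rewrite tE cats0 /= mu_id.
by rewrite run_cons compose_along_cat /= mu_id.
Qed.

Lemma compose_along_run0 s n : compose_along mu s (run s 0 n) s = id.
Proof.
elim: n => [|n IHn]; first exact: mu_id.
by rewrite run_rcons mul0rn addr0 compose_along_rcons IHn mu_id.
Qed.

Lemma compose_along_refine m s h n t : (0 < m)%N -> t = s + h *+ n ->
  compose_along (fun x y => compose_along mu x (run x ((y - x) / m%:R) m) y)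
    s (run s h n) t =
  compose_along mu s (run s (h / m%:R) (n * m)) t.
Proof.
move=> m0; elim: n t => [|n IHn] t tE.
  rewrite mulr0n addr0 in tE; subst t.
  by rewrite /= subrr mul0r compose_along_run0 mu_id.
have mE : h / m%:R *+ m = h.
  by rewrite -mulr_natr mulfVK // pnatr_eq0 -lt0n.
rewrite run_rcons compose_along_rcons IHn // mulSnr run_cat.
have -> : s + h / m%:R *+ (n * m) = s + h *+ n by rewrite mulnC mulrnA mE.
have tuE : t - (s + h *+ n) = h by rewrite tE mulrSr; ring.
by rewrite compose_along_run /= ?tuE // mE tE mulrSr addrA.
Qed.

End Unital.

End Compositions.

(** * Estimates for an approximate flow *)

Definition uniform {R : realType} {M : R -> pseudoMetricType R}
    (mu : forall s t : R, M t -> M s) (s t : R) (N : nat) : M t -> M s :=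
  compose_along mu s (run s ((t - s) / N%:R) N) t.
Arguments uniform {R M} mu s t N.

Section ApproximateFlow.
Context {R : realType} {M : R -> pseudoMetricType R}.
Context (M_metric : forall t, ext_metric (M t)).
Context (M_complete : forall t, seq_complete (M t)).
Context {mu : forall s t : R, M t -> M s} {f : R -> R} {eps : R} {k : nat}.
Context {a b C : 'I_k -> R} {g : R -> R}.
Arguments mu : clear implicits.
Context (mu_aflow : local_approximate_flow mu f eps a b C g).
Implicit Types (s t u x y h d T : R) (p q : seq R) (m n N : nat).

Let mu_id := aflow_id mu_aflow.
Let eps_gt0 := aflow_eps mu_aflow.

Let order_gt0 : 0 < 1 + eps.
Proof. by rewrite addr_gt0. Qed.

Let order_neq0 : 1 + eps != 0.
Proof. by rewrite gt_eqF. Qed.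

Let powR00 : 0 `^ (1 + eps) = 0 :> R.
Proof. exact: powR0. Qed.

Lemma powR_order_le x y : 0 <= x -> x <= y -> x `^ (1 + eps) <= y `^ (1 + eps).
Proof.
move=> x0 xy; rewrite ge0_ler_powR ?nnegrE //; first exact: ltW.
exact: le_trans xy.
Qed.

(** The constants [C i] may be negative. Their sum governs the defect of [mu]
    at a midpoint, where all the terms of the bound have equal powers; at the
    other points the sum of their absolute values is used. *)
Let S : R := \sum_(i < k) C i.
Let K : R := \sum_(i < k) `|C i|.

Let K_ge0 : 0 <= K.
Proof. by apply: sumr_ge0. Qed.

Lemma defect_le s t u d : `|t - u| <= d -> `|u - s| <= d ->
  uclose (K * d `^ (1 + eps)) (mu s t) (mu s u \o mu u t).
Proof.
move=> tu us; have d0 : 0 <= d := le_trans (normr_ge0 _) tu.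
apply: uclose_le (supdist_uclose (aflow_comp mu_aflow s t u)).
rewrite /K mulr_suml; apply: ler_sum => i _.
have [a0 b0 ab] := aflow_ab mu_aflow i.
rewrite -ab powRD ?ab ?(negPf order_neq0) // mulrA.
have powle x r : 0 < r -> 0 <= x -> x <= d -> x `^ r <= d `^ r.
  by move=> r0 x0 xd; rewrite ge0_ler_powR ?nnegrE // ltW.
apply: (@le_trans _ _ (`|C i| * `|t - u| `^ a i * `|u - s| `^ b i)).
  by rewrite !ler_wpM2r ?powR_ge0 // ler_norm.
by rewrite !ler_pM ?mulr_ge0 ?powR_ge0 ?powle.
Qed.

Lemma defect_midpoint s t u d : `|t - u| = d -> `|u - s| = d ->
  (supdist (mu s t) (mu s u \o mu u t) <= (S * d `^ (1 + eps))%:E)%E.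
Proof.
move=> tu us; apply: (le_trans (aflow_comp mu_aflow s t u)).
rewrite lee_fin tu us /S mulr_suml; apply: ler_sum => i _.
have [a0 b0 ab] := aflow_ab mu_aflow i.
by rewrite -ab powRD ?ab ?(negPf order_neq0) // mulrA.
Qed.

Lemma sum_C_ge0 : 0 <= S.
Proof.
(* The defect at the midpoint of the interval between 0 and 2 is at most [S]. *)
have h1 : `|2 - 1| = 1 :> R by rewrite [2 - 1](_ : _ = 1) ?normr1 //; ring.
have h2 : `|1 - 0| = 1 :> R by rewrite subr0 normr1.
have := le_trans (supdist_ge0 _ _) (defect_midpoint h1 h2).
by rewrite lee_fin powR1 mulr1.
Qed.

Lemma g_ge1 T : 0 <= T -> 1 <= g T.
Proof. exact: (aflow_g_ge1 mu_aflow). Qed.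

Lemma g_ge0 T : 0 <= T -> 0 <= g T.
Proof. by move=> /g_ge1; apply: le_trans. Qed.

Lemma compose_along_expands T s p t : total_length s p t <= T ->
  expands_by (g T) (compose_along mu s p t).
Proof.
move=> lT; apply: Lip_expands => //.
apply: (le_trans (aflow_Lip_along mu_aflow s p t)).
by rewrite lee_fin (aflow_g_homo mu_aflow) // total_length_ge0.
Qed.

(** Removing the first inner point again and again costs one defect per point
    and expands nothing; the bound is linear in the number of points. *)
Lemma compose_along_crude T s p t : total_length s p t <= T ->
  uclose ((size p)%:R * (K * T `^ (1 + eps))) (compose_along mu s p t) (mu s t).
Proof.
elim: p => [|u p IHp] lT.
  by rewrite mul0r; exact: uclose_refl.
have step : total_length s p t <= T /\
    uclose (K * T `^ (1 + eps)) (compose_along mu s (u :: p) t)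
      (compose_along mu s p t).
  case: p lT {IHp} => [|v p] /=; rewrite /total_length /steps /= !big_cons.
    rewrite !big_nil !addr0 => lT; split.
      apply: le_trans lT.
      by rewrite [leRHS]addrC ler_distD.
    apply: uclose_sym; apply: defect_le; apply: le_trans lT.
      by rewrite lerDr.
    by rewrite lerDl.
  set r := \sum_(_ <- _) _; move=> lT.
  have r0 : 0 <= r := total_length_ge0 v p t.
  have tri : `|v - s| <= `|u - s| + `|v - u|.
    by rewrite [leRHS]addrC ler_distD.
  split; first by apply: le_trans lT; rewrite addrA lerD2r.
  apply: uclose_sym.
  apply: (@uclose_comp _ _ _ _ _ (mu s v) (mu s u \o mu u v)).
  by apply: defect_le; apply: le_trans lT; rewrite ?lerDl ?addr_ge0 //;
    rewrite addrCA lerDl addr_ge0.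
have [lpT close_p] := step.
rewrite [size _]/= mulrSr mulrDl mul1r addrC.
exact: uclose_trans close_p (IHp lpT).
Qed.

Lemma uniform_expands T s t N : (0 < N)%N -> `|t - s| <= T ->
  expands_by (g T) (uniform mu s t N).
Proof.
by move=> N0 tsT; apply: compose_along_expands; rewrite uniform_length.
Qed.

Lemma uniform1 s t : uniform mu s t 1 = mu s t.
Proof. by rewrite /uniform /run /= addr0 mu_id. Qed.

Lemma uniform_refine_close T s t N m (e : R -> R) :
  (0 < N)%N -> (0 < m)%N -> (forall d, 0 <= e d) -> e 0 = 0 ->
  (forall x y, `|y - x| <= T -> uclose (e `|y - x|) (mu x y) (uniform mu x y m)) ->
  `|t - s| <= T ->
  uclose (g T * (N%:R * e (`|t - s| / N%:R)))
    (uniform mu s t N) (uniform mu s t (N * m)).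
Proof.
move=> N0 m0 e_ge0 e0 mum tsT.
have T0 : 0 <= T := le_trans (normr_ge0 _) tsT.
have := @compose_along_uclose _ _ mu (fun x y => uniform mu x y m) T (g T) e
  (g_ge1 T0) e_ge0 (@compose_along_expands T) mum s (run s ((t - s) / N%:R) N) t.
rewrite uniform_length // => /(_ tsT).
rewrite (sum_steps_run e s [::] (uniform_end s t N0)) /steps big_seq1.
rewrite subrr normr0 e0 add0r normrM normfV normr_nat mulr_natl.
rewrite (compose_along_refine mu_id m0 (uniform_end s t N0)).
by rewrite -mulrA -invfM -natrM.
Qed.

(** Up to the constants [g] and [S], halving [2 ^ n] steps of equal length
    costs [2 ^ n * (|t - s| / 2 ^ n.+1) ^ (1 + eps)], which [zeta_block] compares
    to the terms of the zeta series of ranks [2 ^ n + 1] to [2 ^ n.+1]. *)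
Lemma dyadic_step s t n :
  uclose (g `|t - s| * S * `|t - s| `^ (1 + eps) *
      (series (riemannR (1 + eps)) (2 ^ n.+1)%N -
       series (riemannR (1 + eps)) (2 ^ n)%N))
    (uniform mu s t (2 ^ n)) (uniform mu s t (2 ^ n.+1)).
Proof.
pose e d := S * (d / 2) `^ (1 + eps).
have e_ge0 d : 0 <= e d by rewrite mulr_ge0 ?powR_ge0 ?sum_C_ge0.
have e0 : e 0 = 0 by rewrite /e mul0r powR00 mulr0.
have half x y : `|y - x| <= `|t - s| ->
    uclose (e `|y - x|) (mu x y) (uniform mu x y 2).
  move=> _; rewrite /uniform /run /= addr0 mu_id /=.
  have halfE : `|(y - x) / 2| = `|y - x| / 2.
    by rewrite normrM normfV normr_nat.
  apply: supdist_uclose; rewrite /e -halfE.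
  by apply: defect_midpoint; congr `|_|; rewrite mulr1n; field.
have n0 : (0 < 2 ^ n)%N by rewrite expn_gt0.
rewrite expnSr.
have := @uniform_refine_close _ s t _ 2 e n0 isT e_ge0 e0 half (lexx _).
apply: uclose_le; rewrite -!mulrA ler_wpM2l ?g_ge0 // /e mulrCA.
rewrite ler_wpM2l ?sum_C_ge0 // -mulrA -invfM -natrM.
rewrite powRM ?invr_ge0 // mulrCA ler_wpM2l ?powR_ge0 //.
have := zeta_block eps_gt0 (2 ^ n)%N; rewrite -muln2.
by rewrite -[X in _ * X `^ _]powR_inv1 // -powRrM mulN1r powRN.
Qed.

(** What remains of the series of [dyadic_step] from the level [n] on: the
    speed of convergence of the dyadic compositions. *)
Definition dyadic_rate h n : R :=
  g h * S * h `^ (1 + eps) *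
  (zeta (1 + eps) - series (riemannR (1 + eps)) (2 ^ n)%N).

Lemma dyadic_cauchy s t n m : (n <= m)%N ->
  uclose (dyadic_rate `|t - s| n) (uniform mu s t (2 ^ n))
    (uniform mu s t (2 ^ m)).
Proof.
move=> nm; pose c := g `|t - s| * S * `|t - s| `^ (1 + eps).
have c0 : 0 <= c by rewrite !mulr_ge0 ?g_ge0 ?powR_ge0 ?sum_C_ge0.
apply: (@uclose_le _ _ _ (c * (series (riemannR (1 + eps)) (2 ^ m)%N -
  series (riemannR (1 + eps)) (2 ^ n)%N))).
  by rewrite ler_wpM2l // lerD2r le_zeta.
rewrite -(subnKC nm); elim: (m - n)%N => [|l IHl].
  by rewrite addn0 subrr mulr0; exact: uclose_refl.
rewrite addnS; have := uclose_trans IHl (@dyadic_step s t (n + l)).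
by apply: uclose_le; rewrite -mulrDr ler_wpM2l // addrC addrA subrK.
Qed.

Lemma dyadic_rate_small h d : 0 <= h -> 0 < d ->
  exists n, forall m, (n <= m)%N -> dyadic_rate h m < d.
Proof.
move=> h0 d0; rewrite /dyadic_rate; set c := _ * _ `^ _.
have c0 : 0 <= c by rewrite !mulr_ge0 ?g_ge0 ?powR_ge0 ?sum_C_ge0.
have c1 : 0 < c + 1 by rewrite ltr_wpDl.
have [n nd] := zeta_tail eps_gt0 (divr_gt0 d0 c1).
exists n => m nm; have m2 : (m <= 2 ^ m)%N by apply: ltnW; exact: ltn_expl.
have := nd (2 ^ m)%N (leq_trans nm m2).
rewrite ltr_pdivlMr // mulrC; apply: le_lt_trans.
by rewrite ler_wpM2r ?lerDl // subr_ge0 le_zeta.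
Qed.

Lemma dyadic_limit : exists phi : forall s t : R, M t -> M s, forall s t n,
  uclose (dyadic_rate `|t - s| n) (uniform mu s t (2 ^ n)) (phi s t).
Proof.
have lim s t (x : M t) : exists l, forall n,
    (edist (uniform mu s t (2 ^ n) x, l) <= (dyadic_rate `|t - s| n)%:E)%E.
  apply: complete_cvg_rate => //; last by move=> n m nm; exact: dyadic_cauchy.
  move=> e e0; have [n ne] := dyadic_rate_small (normr_ge0 (t - s)) e0.
  by exists n; exact: ne.
exists (fun s t (x : M t) => projT1 (cid (lim s t x))) => s t n x.
by case: cid => l /=.
Qed.

(** The two sequences are the sides of a ladder whose rungs are no longer than
    [d]. Once the side [p] up to [x] is replaced by the side [q] up to [y] and
    the rung [mu y x], the next step on the side of [p] becomes a step on the
    side of [q] followed by a rung, at the cost of two defects of size [d]: the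
    two ways around each of the triangles into which the diagonal cuts the cell
    are compared. *)
Lemma ladder_close T d (c : R) s p q x y h1 h2 n x' y' :
  uclose c (compose_along mu s p x) (compose_along mu s q y \o mu y x) ->
  total_length s q y + `|h2| *+ n <= T -> `|h1| <= d -> `|h2| <= d ->
  (forall i, (i <= n)%N -> `|(x + h1 *+ i) - (y + h2 *+ i)| <= d) ->
  x' = x + h1 *+ n -> y' = y + h2 *+ n ->
  uclose (c + n%:R * (g T * (2 * (K * d `^ (1 + eps)))))
    (compose_along mu s (p ++ run x h1 n) x')
    (compose_along mu s (q ++ run y h2 n) y' \o mu y' x').
Proof.
move=> start; elim: n x' y' => [|n IHn] x' y' lT h1d h2d near_d -> ->.
  by rewrite !mulr0n !addr0 !cats0 mul0r addr0.
have {}IHn : uclose (c + n%:R * (g T * (2 * (K * d `^ (1 + eps)))))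
    (compose_along mu s (p ++ run x h1 n) (x + h1 *+ n))
    (compose_along mu s (q ++ run y h2 n) (y + h2 *+ n) \o
     mu (y + h2 *+ n) (x + h1 *+ n)).
  apply: IHn => //; last by move=> i iN; apply: near_d; exact: leqW.
  by apply: le_trans lT; rewrite lerD2l mulrSr lerDl.
rewrite !run_rcons -!rcons_cat !compose_along_rcons.
set x1 := x + h1 *+ n in IHn *; set x2 := x + h1 *+ n.+1.
set y1 := y + h2 *+ n in IHn *; set y2 := y + h2 *+ n.+1.
have x12 : `|x2 - x1| <= d by rewrite [x2 - x1](_ : _ = h1) // /x2 mulrSr /x1; ring.
have y12 : `|y2 - y1| <= d by rewrite [y2 - y1](_ : _ = h2) // /y2 mulrSr /y1; ring.
have qG : expands_by (g T) (compose_along mu s (q ++ run y h2 n) y1).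
  apply: compose_along_expands; rewrite (total_length_run s q (erefl y1)).
  by apply: le_trans lT; rewrite lerD2l mulrSr lerDl.
have def1 := uclose_sym (@defect_le y1 x2 x1 d x12 (near_d n (leqnSn n))).
have def2 := @defect_le y1 x2 y2 d (near_d n.+1 (leqnn _)) y12.
have := uclose_trans (uclose_comp (mu x1 x2) IHn)
  (expands_uclose qG (uclose_trans def1 def2)).
by apply: uclose_le; rewrite -natr1 le_eqVlt; apply/orP; left; apply/eqP; ring.
Qed.

(** Going along a run and back: the innermost factors [mu x x' \o mu x' x] are
    close to [mu x x = id], and can be removed first. *)
Lemma run_back_close T s h n x : x = s + h *+ n -> `|h| *+ n <= T ->
  uclose (n%:R * (g T * (K * `|h| `^ (1 + eps))))
    (compose_along mu s (run s h n) x \o compose_along mu x (run x (- h) n) s)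
    id.
Proof.
elim: n x => [|n IHn] x' x'E lT.
  rewrite mulr0n addr0 in x'E; subst x'.
  by rewrite /= mu_id mul0r; exact: uclose_refl.
have lnT : `|h| *+ n <= T by apply: le_trans lT; rewrite mulrSr lerDl.
pose x := s + h *+ n.
have xE : x' = x + h by rewrite x'E mulrSr addrA.
have sE : s = x + (- h) *+ n by rewrite /x mulNrn addrK.
rewrite run_rcons compose_along_rcons run_cons /= mu_id.
have -> : x' + - h = x by rewrite xE addrK.
rewrite -[run x (- h) n]cat0s (compose_along_run mu_id x' [::] sE) /=.
have pG : expands_by (g T) (compose_along mu s (run s h n) x).
  apply: compose_along_expands; rewrite (total_length_run s [::] (erefl x)).
  by rewrite total_length_nil subrr normr0 add0r.
have def : uclose (K * `|h| `^ (1 + eps)) (mu x x' \o mu x' x) id.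
  apply: uclose_sym; rewrite -(mu_id x).
  by apply: defect_le; rewrite xE; [rewrite opprD addrA subrr sub0r normrN|
    rewrite addrC addKr].
have := uclose_trans (expands_uclose pG
  (uclose_comp (compose_along mu x (run x (- h) n) s) def)) (IHn x erefl lnT).
by apply: uclose_le; rewrite mulrSr [leRHS]mulrDl mul1r addrC.
Qed.

(** * The limit flow *)

Section Limit.
Context {phi : forall s t : R, M t -> M s}.
Arguments phi : clear implicits.
Context (phi_limit : forall s t n,
  uclose (dyadic_rate `|t - s| n) (uniform mu s t (2 ^ n)) (phi s t)).

Let zeta_ge0 : 0 <= zeta (1 + eps).
Proof. by apply: le_trans (le_zeta eps_gt0 0); rewrite /series /= big_geq. Qed.

Let dyadic_rate0_le h : 0 <= h ->
  dyadic_rate h 0 <= g h * S * zeta (1 + eps) * h `^ (1 + eps).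
Proof.
move=> h0; rewrite /dyadic_rate [leRHS]mulrAC ler_wpM2l //.
  by rewrite !mulr_ge0 ?g_ge0 ?powR_ge0 ?sum_C_ge0.
rewrite lerBlDr lerDl /series /= expn0 big_nat1.
by rewrite ltW // riemannR_gt0 // ltW.
Qed.

Lemma limit_close s t :
  uclose (g `|t - s| * S * zeta (1 + eps) * `|t - s| `^ (1 + eps))
    (phi s t) (mu s t).
Proof.
apply: uclose_sym; rewrite -uniform1 -(expn0 2).
exact: uclose_le (dyadic_rate0_le (normr_ge0 _)) (@phi_limit s t 0).
Qed.

Let B T : R := g T * (g T * S * zeta (1 + eps)).

Let B_ge0 T : 0 <= T -> 0 <= B T.
Proof. by move=> T0; rewrite !mulr_ge0 ?g_ge0 ?sum_C_ge0. Qed.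

(** The limit of the dyadic subdivisions is also the limit of all the uniform
    ones: the subdivision into [N * 2 ^ n] parts refines both the one into [N]
    parts and the one into [2 ^ n] parts. For fixed [N] it gets close to the
    latter as [n] grows, since cutting each step of length [|t - s| / 2 ^ n]
    into [N] parts costs [N] small defects. *)
Lemma uniform_limit_close T s t N : (0 < N)%N -> `|t - s| <= T ->
  uclose (B T * (N%:R * (`|t - s| / N%:R) `^ (1 + eps)))
    (uniform mu s t N) (phi s t).
Proof.
move=> N0 tsT; have T0 : 0 <= T := le_trans (normr_ge0 _) tsT.
move=> x; apply: edist_le_lim => e e0; move: x.
have e2 : 0 < e / 2 by rewrite divr_gt0.
have K'0 : 0 <= g T * (N%:R * K) by rewrite !mulr_ge0 ?g_ge0.
have [n1 small1] := dyadic_rate_small (normr_ge0 (t - s)) e2.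
have [n2 small2] := uniform_sum_small eps_gt0 (normr_ge0 (t - s)) K'0 e2.
pose n := maxn n1 n2.
have n0 : (0 < 2 ^ n)%N by rewrite expn_gt0.
have close1 : uclose (B T * (N%:R * (`|t - s| / N%:R) `^ (1 + eps)))
    (uniform mu s t N) (uniform mu s t (N * 2 ^ n)).
  pose e1 d := g T * S * zeta (1 + eps) * d `^ (1 + eps).
  have := @uniform_refine_close T s t N (2 ^ n) e1 N0 n0.
  rewrite /B mulrCA !mulrA => refine_close; apply: uclose_le (refine_close _ _ _ tsT).
  - by rewrite /e1 le_eqVlt; apply/orP; left; apply/eqP; ring.
  - by move=> d; rewrite !mulr_ge0 ?g_ge0 ?powR_ge0 ?sum_C_ge0.
  - by rewrite /e1 powR00 mulr0.
  move=> x y xyT; rewrite -uniform1 -(expn0 2).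
  apply: uclose_le (@dyadic_cauchy x y 0 n (leq0n _)).
  apply: le_trans (dyadic_rate0_le (normr_ge0 _)) _.
  by rewrite !ler_wpM2r ?powR_ge0 ?sum_C_ge0 // (aflow_g_homo mu_aflow).
have close2 : uclose (g T * (N%:R * K) *
      ((2 ^ n)%:R * (`|t - s| / (2 ^ n)%:R) `^ (1 + eps)))
    (uniform mu s t (2 ^ n)) (uniform mu s t (2 ^ n * N)).
  pose e1 d := N%:R * (K * d `^ (1 + eps)).
  have := @uniform_refine_close T s t (2 ^ n) N e1 n0 N0.
  move=> refine_close; apply: uclose_le (refine_close _ _ _ tsT).
  - by rewrite /e1 le_eqVlt; apply/orP; left; apply/eqP; ring.
  - by move=> d; rewrite !mulr_ge0 ?powR_ge0.
  - by rewrite /e1 powR00 !mulr0.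
  move=> x y _; apply: uclose_sym.
  have := @compose_along_crude `|y - x| x (run x ((y - x) / N%:R) N) y.
  by rewrite uniform_length // size_mkseq => /(_ (lexx _)).
rewrite mulnC in close2.
have := uclose_trans (uclose_trans close1 (uclose_sym close2)) (@phi_limit s t n).
apply: uclose_le; rewrite -addrA lerD2l [leRHS](splitr e) lerD // ltW //.
  by apply: small2; rewrite (leq_ltn_trans (leq_maxr n1 n2)) // ltn_expl.
by apply: small1; exact: leq_maxl.
Qed.

Lemma limit_expands T s t : `|t - s| <= T -> expands_by (g T) (phi s t).
Proof.
move=> tsT x y c xy; apply: edist_le_lim => e e0.
have T0 : 0 <= T := le_trans (normr_ge0 _) tsT.
have B2 : 0 <= 2 * B T by rewrite mulr_ge0 ?B_ge0.
have [n small] := uniform_sum_small eps_gt0 (normr_ge0 (t - s)) B2 e0.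
have Uphi := @uniform_limit_close T s t n.+1 isT tsT.
have := edist_trans (edist_trans (uclose_sym Uphi x)
  (uniform_expands (ltn0Sn n) tsT xy)) (Uphi y).
move=> /le_trans; apply; rewrite lee_fin.
have := small n.+1 (ltnSn n); lra.
Qed.

Lemma limit_id s : phi s s = id.
Proof.
apply: uclose_eq => // e e0; apply: uclose_sym.
have := @uniform_limit_close 0 s s 1 isT.
rewrite uniform1 mu_id subrr normr0 mul0r powR00 !mulr0 => /(_ (lexx _)).
by apply: uclose_le; exact: ltW.
Qed.

(** To compose [phi s u] and [phi u t], subdivide the first interval into [m]
    parts and the second one into [l] parts, just enough for them to be shorter. The [i]-th point of this subdivision is within one step of the
    [i]-th point of the subdivision of the whole interval into [m + l] parts,
    so that the ladder applies with [d] of order [1 / m]. *)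
Lemma limit_comp_between s t u (rho : R) : 0 < rho -> t - u = rho * (u - s) ->
  phi s t = phi s u \o phi u t.
Proof.
move=> rho0 tuE; apply: uclose_eq => // e e0.
pose T := `|u - s| + `|t - u|.
have usT : `|u - s| <= T by rewrite lerDl.
have tuT : `|t - u| <= T by rewrite lerDr.
have tsT : `|t - s| <= T by rewrite /T [leRHS]addrC ler_distD.
have T0 : 0 <= T := le_trans (normr_ge0 _) tsT.
pose Q := B T + g T * (2 * K) + g T * B T + B T.
have Q0 : 0 <= Q * (2 + rho).
  apply: mulr_ge0; last by rewrite addr_ge0 // ltW.
  have gT0 := g_ge0 T0; have BT0 := B_ge0 T0.
  have q1 : 0 <= g T * (2 * K) by rewrite mulr_ge0 // mulr_ge0.
  have q2 : 0 <= g T * B T by rewrite mulr_ge0.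
  by rewrite /Q; apply: addr_ge0 => //; apply: addr_ge0 => //; apply: addr_ge0.
(* [Q] collects the constants of the four comparisons below, and [2 + rho]
   bounds the ratio of the total number of steps to [m]. *)
have [m0 /(_ m0.+1 (ltnSn _))] :=
  uniform_sum_small eps_gt0 (normr_ge0 (u - s)) Q0 e0.
pose m := m0.+1; pose l := (Num.truncn (rho * m%:R)).+1.
have m1 : 1 <= m%:R :> R by rewrite ler1n.
have /andP[l1 l2] : rho * m%:R <= l%:R <= rho * m%:R + 1.
  have rm0 : 0 <= rho * m%:R by rewrite mulr_ge0 // ltW.
  have /andP[lo hi] := truncn_itv rm0.
  by rewrite (ltW hi) /l -natr1 lerD2r.
have l0 : 0 < l%:R :> R by rewrite ltr0n.
rewrite -/m; set mm : R := m%:R in m1 l1 l2 *; set ll : R := l%:R in l1 l2 l0 *.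
have mm0 : 0 < mm by apply: lt_le_trans m1.
have tsE : t - s = (1 + rho) * (u - s) by rewrite mulrDl mul1r -tuE; ring.
pose eta := (u - s) / mm; pose eta2 := (t - u) / ll; pose bar := (t - s) / (mm + ll).
have etaE : `|eta| = `|u - s| / mm by rewrite /eta normrM normfV (gtr0_norm mm0).
have eta2E : `|eta2| = `|t - u| / ll by rewrite /eta2 normrM normfV (gtr0_norm l0).
have barE : `|bar| = `|t - s| / (mm + ll).
  by rewrite /bar normrM normfV (gtr0_norm (addr_gt0 mm0 l0)).
have eta2_le : `|eta2| <= `|eta|.
  rewrite eta2E etaE tuE normrM gtr0_norm // ler_pdivrMr // mulrAC ler_pdivlMr //.
  by rewrite mulrAC [leRHS]mulrC ler_wpM2r.
have bar_le : `|bar| <= `|eta|.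
  rewrite barE etaE tsE normrM gtr0_norm ?addr_gt0 // ler_pdivrMr ?addr_gt0 //.
  rewrite mulrAC ler_pdivlMr // mulrAC [leRHS]mulrC ler_wpM2r //.
  by rewrite mulrDl mul1r lerD2l.
have mlE : (m + l)%:R = mm + ll by rewrite natrD.
(* Both sequences are affine on each piece, so that their distance is largest
   at the [m]-th points, where it is [|eta| * m * (l - rho * m) / (m + l)]. *)
have near1 i : (i <= m)%N -> `|(s + eta *+ i) - (s + bar *+ i)| <= `|eta|.
  move=> im; have im' : i%:R <= mm by rewrite ler_nat.
  have -> : (s + eta *+ i) - (s + bar *+ i) =
      eta * (i%:R * (ll - rho * mm) / (mm + ll)).
    rewrite /eta /bar tsE -[_ *+ i]mulr_natr -[X in _ - (_ + X)]mulr_natr.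
    by field; rewrite !gt_eqF ?addr_gt0.
  rewrite normrM ler_piMr // ger0_norm.
    rewrite ler_pdivrMr ?addr_gt0 // mul1r.
    apply: (@le_trans _ _ (i%:R * 1)); last by rewrite mulr1 (le_trans im') ?lerDl ?ltW.
    by rewrite ler_wpM2l // lerBlDr addrC.
  by rewrite !mulr_ge0 ?invr_ge0 ?subr_ge0 // ltW // addr_gt0.
have near2 i : (i <= l)%N ->
    `|(u + eta2 *+ i) - ((s + bar *+ m) + bar *+ i)| <= `|eta|.
  move=> il; have il' : i%:R <= ll by rewrite ler_nat.
  have -> : (u + eta2 *+ i) - ((s + bar *+ m) + bar *+ i) =
      eta * (mm * (ll - rho * mm) / (mm + ll) * (1 - i%:R / ll)).
    have uE : u = s + (u - s) by rewrite addrC subrK.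
    rewrite {1}uE /eta /eta2 /bar tsE tuE -[_ *+ m]mulr_natr.
    rewrite -[_ *+ i]mulr_natr -[X in _ - (_ + X)]mulr_natr -/mm.
    by field; rewrite !gt_eqF ?addr_gt0.
  have i1 : i%:R / ll <= 1 by rewrite ler_pdivrMr // mul1r.
  have i0 : 0 <= i%:R / ll by rewrite divr_ge0 // ltW.
  rewrite normrM ler_piMr // ger0_norm.
    rewrite mulr_ile1 ?subr_ge0 //.
    - by rewrite !mulr_ge0 ?invr_ge0 ?subr_ge0 // ltW // addr_gt0.
    - rewrite ler_pdivrMr ?addr_gt0 // mul1r.
      apply: (@le_trans _ _ (mm * 1)); last by rewrite mulr1 lerDl ltW.
      by rewrite ler_wpM2l ?lerBlDr 1?addrC // ltW.
    by rewrite lerBlDr lerDl.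
  rewrite mulr_ge0 ?subr_ge0 //.
  by rewrite !mulr_ge0 ?invr_ge0 ?subr_ge0 // ltW // addr_gt0.
have mP : (0 < m)%N by []. have lP : (0 < l)%N by [].
have mlP : (0 < m + l)%N by rewrite addn_gt0.
have uE : u = s + eta *+ m := uniform_end s u mP.
have tE : t = u + eta2 *+ l := uniform_end u t lP.
have tE' : t = (s + bar *+ m) + bar *+ l.
  by rewrite -addrA -mulrnDr /bar -mlE; exact: uniform_end.
have ladder : uclose ((mm + ll) * (g T * (2 * (K * `|eta| `^ (1 + eps)))))
    (uniform mu s u m \o uniform mu u t l) (uniform mu s t (m + l)).
  have start : uclose 0 (compose_along mu s [::] s)
      (compose_along mu s [::] s \o mu s s).
    by rewrite /= mu_id; exact: uclose_refl.
  have len1 : total_length s [::] s + `|bar| *+ m + `|bar| *+ l <= T.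
    rewrite total_length_nil subrr normr0 add0r -mulrnDr barE -[leLHS]mulr_natr.
    by rewrite mlE mulfVK // gt_eqF // addr_gt0.
  have half1 := @ladder_close T `|eta| 0 s [::] [::] s s eta bar m u _ start
    (le_trans (ler_wpDr _ (lexx _)) len1) (lexx _) bar_le near1 uE erefl.
  have := @ladder_close T `|eta| _ s _ _ u (s + bar *+ m) eta2 bar l t t
    (half1 _) _ eta2_le bar_le near2 tE tE'.
  rewrite (total_length_run s [::] (erefl (s + bar *+ m))) => /(_ _ len1).
  rewrite !cat0s -run_cat (compose_along_run mu_id _ _ tE) mu_id.
  rewrite /uniform -/eta -/eta2 mlE -/bar add0r -mulrDl; apply.
  by rewrite mulrn_wge0.
have Uphi1 := @uniform_limit_close T s u m mP usT.
have Uphi2 := @uniform_limit_close T u t l lP tuT.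
have Uphi3 := @uniform_limit_close T s t (m + l) mlP tsT.
have := uclose_trans (uclose_trans (uclose_sym Uphi3) (uclose_sym ladder))
  (uclose_trans (expands_uclose (uniform_expands mP usT) Uphi2)
     (uclose_comp (phi u t) Uphi1)).
rewrite mlE -barE -eta2E -etaE => close small; apply: uclose_le close.
apply/ltW/(le_lt_trans _ small).
have := powR_order_le (normr_ge0 _) eta2_le; have := powR_order_le (normr_ge0 _) bar_le.
set X := `|eta| `^ _; set X1 := `|bar| `^ _; set X2 := `|eta2| `^ _ => X1X X2X.
have X0 : 0 <= X by exact: powR_ge0.
have mmX : mm * X <= (2 + rho) * (mm * X).
  by rewrite ler_peMl ?mulr_ge0 ?(ltW mm0) // (@le_trans _ _ 2) ?ler1n ?lerDl ?ltW.
have mlX : (mm + ll) * X <= (2 + rho) * (mm * X).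
  rewrite mulrA ler_wpM2r // mulrDl; lra.
have BT0 := B_ge0 T0; have gT0 := g_ge0 T0.
have le1 : B T * ((mm + ll) * X1) <= B T * ((2 + rho) * (mm * X)).
  apply: ler_wpM2l => //; apply: le_trans mlX; apply: ler_wpM2l => //.
  by rewrite addr_ge0 // ltW.
have le2 : (mm + ll) * (g T * (2 * (K * X))) <=
    g T * (2 * K) * ((2 + rho) * (mm * X)).
  have -> : (mm + ll) * (g T * (2 * (K * X))) =
    g T * (2 * K) * ((mm + ll) * X) by ring.
  by apply: ler_wpM2l => //; rewrite mulr_ge0 // mulr_ge0.
have le3 : g T * (B T * (ll * X2)) <= g T * B T * ((2 + rho) * (mm * X)).
  rewrite mulrA; apply: ler_wpM2l; first by rewrite mulr_ge0.
  apply: le_trans mlX; apply: ler_pM => //; rewrite ?powR_ge0 ?(ltW l0) //.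
  by rewrite lerDr ltW.
have le4 : B T * (mm * X) <= B T * ((2 + rho) * (mm * X)).
  exact: ler_wpM2l.
have -> : Q * (2 + rho) * (mm * X) = Q * ((2 + rho) * (mm * X)) by ring.
rewrite /Q !mulrDl; lra.
Qed.

Lemma limit_inverse s u : phi s u \o phi u s = id.
Proof.
apply: uclose_eq => // e e0; pose T := `|u - s|.
have T0 : 0 <= T by exact: normr_ge0.
have Q0 : 0 <= B T + g T * B T + g T * K.
  have BT0 := B_ge0 T0; have gT0 := g_ge0 T0.
  by apply: addr_ge0; [apply: addr_ge0 => //|]; rewrite mulr_ge0.
have [n /(_ n.+1 (ltnSn _)) small] := uniform_sum_small eps_gt0 T0 Q0 e0.
have suT : `|s - u| <= T by rewrite distrC.
have U1 := @uniform_limit_close T s u n.+1 isT (lexx _).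
have U2 := @uniform_limit_close T u s n.+1 isT suT.
pose h := (u - s) / n.+1%:R.
have hE : `|h| = T / n.+1%:R by rewrite /h normrM normfV normr_nat.
have back : uclose (n.+1%:R * (g T * (K * `|h| `^ (1 + eps))))
    (uniform mu s u n.+1 \o uniform mu u s n.+1) id.
  rewrite /uniform -/h; have -> : (s - u) / n.+1%:R = - h by rewrite -mulNr opprB.
  apply: run_back_close; first exact: uniform_end.
  by rewrite hE -[leLHS]mulr_natr mulfVK.
have := uclose_trans (uclose_trans (uclose_sym (uclose_comp (phi u s) U1))
  (uclose_sym (expands_uclose (uniform_expands (ltn0Sn n) (lexx T)) U2))) back.
apply: uclose_le; apply/ltW/(le_lt_trans _ small).
rewrite hE [`|s - u|]distrC -/T le_eqVlt; apply/orP; left; apply/eqP; ring.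
Qed.

Lemma limit_comp s t u : phi s t = phi s u \o phi u t.
Proof.
have between a0 b0 c0 : 0 < (b0 - c0) * (c0 - a0) ->
    phi a0 b0 = phi a0 c0 \o phi c0 b0.
  move=> pos; have ca : c0 - a0 != 0.
    by apply: contraTneq pos => ->; rewrite mulr0 ltxx.
  apply: (@limit_comp_between _ _ _ ((b0 - c0) / (c0 - a0))).
    have -> : (b0 - c0) / (c0 - a0) = (b0 - c0) * (c0 - a0) / (c0 - a0) ^+ 2.
      by field.
    by rewrite divr_gt0 // exprn_even_gt0.
  by rewrite mulfVK.
(* Of three distinct reals one is between the two others. *)
have [->|us] := eqVneq u s; first by rewrite limit_id.
have [->|ut] := eqVneq u t; first by rewrite limit_id.
have [<-|st] := eqVneq s t; first by rewrite limit_inverse limit_id.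
have [pos|npos] := ltP 0 ((t - u) * (u - s)); first exact: between.
have [pos|npos'] := ltP 0 ((u - t) * (t - s)).
  by rewrite (between _ _ _ pos) -compA limit_inverse.
have neg : (t - u) * (u - s) < 0.
  by rewrite lt_neqAle npos andbT mulf_neq0 // subr_eq0 // eq_sym.
have neg' : (u - t) * (t - s) < 0.
  by rewrite lt_neqAle npos' andbT mulf_neq0 // subr_eq0 // eq_sym.
have pos : 0 < (t - s) * (s - u) by nra.
by rewrite (between _ _ _ pos) compA limit_inverse.
Qed.

Lemma limit_flow : local_flow phi.
Proof.
split; [|exact: limit_id|exact: limit_comp] => s t.
exact: expands_continuous (@limit_expands _ s t (lexx _)).
Qed.

Lemma limit_close_to_order : close_to_order mu eps phi.
Proof.
move=> T; exists (g `|T| * S * zeta (1 + eps)) => s t tsT.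
have tsT' : `|t - s| <= `|T| by rewrite (le_trans tsT) // ler_norm.
apply: uclose_supdist.
  by rewrite !mulr_ge0 ?powR_ge0 ?g_ge0 ?sum_C_ge0.
apply: uclose_le (@limit_close s t).
by rewrite !ler_wpM2r ?powR_ge0 ?sum_C_ge0 // (aflow_g_homo mu_aflow).
Qed.

End Limit.

(** * Flows of order greater than one are limits of compositions *)

Section NearFlow.
Context {psi : forall s t : R, M t -> M s}.
Arguments psi : clear implicits.
Context (psi_flow : local_flow psi) (psi_close : close_to_order mu eps psi).

Lemma flow_along s p t : compose_along psi s p t = psi s t.
Proof.
by elim: p s => [|u p IHp] s //=; rewrite IHp -(flow_comp psi_flow).
Qed.

(** A flow is its own composition along any subdivision, so that replacing all
    the factors [mu] by factors of the flow measures its distance to the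
    compositions of [mu]. *)
Lemma flow_near_compositions T : 0 <= T -> exists2 c : R, 0 <= c &
  forall s p t, total_length s p t <= T ->
    uclose (c * \sum_(d <- steps s p t) d `^ (1 + eps))
      (compose_along mu s p t) (psi s t).
Proof.
move=> T0; have [C' close_T] := psi_close T.
exists (g T * `|C'|) => [|s p t lT]; first by rewrite mulr_ge0 ?g_ge0.
pose e d := `|C'| * d `^ (1 + eps).
have e_ge0 d : 0 <= e d by rewrite mulr_ge0 ?powR_ge0.
rewrite -mulrA mulr_sumr -(flow_along s p t).
apply: (@compose_along_uclose _ _ mu psi T (g T) e (g_ge1 T0) e_ge0
  (@compose_along_expands T)) lT => x y xyT.
apply/uclose_sym/(uclose_le _ (supdist_uclose (close_T _ _ xyT))).
by rewrite ler_wpM2r ?powR_ge0 // ler_norm.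
Qed.

Lemma flow_uniform_close s t : exists2 c : R, 0 <= c & forall N, (0 < N)%N ->
  uclose (c * (N%:R * (`|t - s| / N%:R) `^ (1 + eps)))
    (uniform mu s t N) (psi s t).
Proof.
have [c c0 close] := flow_near_compositions (normr_ge0 (t - s)).
exists c => // N N0.
have := close s (run s ((t - s) / N%:R) N) t; rewrite uniform_length //.
move=> /(_ (lexx _)).
rewrite (sum_steps_run (fun d => d `^ (1 + eps)) s [::] (uniform_end s t N0)).
rewrite /steps big_seq1 subrr normr0 powR00 add0r normrM normfV normr_nat.
by rewrite mulr_natl.
Qed.

Lemma flow_limit_of_compositions : limit_of_compositions mu psi.
Proof.
move=> s t e e0; have T0 := normr_ge0 (t - s).
have [c c0 close] := flow_near_compositions T0.
pose A := c * `|t - s|; have A0 : 0 <= A by rewrite mulr_ge0.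
have A1 : 0 < A + 1 by rewrite ltr_wpDl.
have eA0 : 0 < e / (A + 1) by rewrite divr_gt0.
exists ((e / (A + 1)) `^ eps^-1) => [|p sub meshp]; first exact: powR_gt0.
have mesh0 : 0 <= mesh s p t by exact: bigmax_ge_id.
have small : mesh s p t `^ eps < e / (A + 1).
  have : mesh s p t `^ eps < ((e / (A + 1)) `^ eps^-1) `^ eps.
    by rewrite gt0_ltr_powR ?nnegrE ?powR_ge0.
  by rewrite -powRrM mulVf ?gt_eqF // powRr1 // ltW.
have len := subdivision_length sub.
have close_p := close s p t; rewrite len in close_p.
apply: (@le_lt_trans _ _ (A * mesh s p t `^ eps)%:E).
  apply: uclose_supdist; first by rewrite mulr_ge0 ?powR_ge0.
  apply: uclose_le (close_p (lexx _)).
  rewrite /A -mulrA ler_wpM2l // [leRHS]mulrC -len; exact: sum_steps_mesh.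
rewrite lte_fin; move: small; rewrite ltr_pdivlMr // => small.
by apply: le_lt_trans small; rewrite mulrDr mulr1 mulrC lerDl powR_ge0.
Qed.

End NearFlow.

Lemma near_flow_unique (phi psi : forall s t : R, M t -> M s) :
  local_flow phi -> close_to_order mu eps phi ->
  local_flow psi -> close_to_order mu eps psi -> phi = psi.
Proof.
move=> phi_flow phi_close psi_flow psi_close.
apply: functional_extensionality_dep => s.
apply: functional_extensionality_dep => t; apply: uclose_eq => // e e0.
have [c1 c10 close1] := flow_uniform_close phi_flow phi_close s t.
have [c2 c20 close2] := flow_uniform_close psi_flow psi_close s t.
have [n /(_ n.+1 (ltnSn _)) small] :=
  uniform_sum_small eps_gt0 (normr_ge0 (t - s)) (addr_ge0 c10 c20) e0.
have := uclose_trans (uclose_sym (close1 n.+1 isT)) (close2 n.+1 isT).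
by apply: uclose_le; rewrite -mulrDl ltW.
Qed.

End ApproximateFlow.

Theorem theorem3p6 (R : realType) (M : R -> pseudoMetricType R)
    (M_metric : forall t, ext_metric (M t))
    (M_complete : forall t, seq_complete (M t))
    (mu : forall s t : R, M t -> M s)
    (f : R -> R) (eps : R) (n : nat) (a b C : 'I_n -> R) (g : R -> R)
    (mu_aflow : local_approximate_flow mu f eps a b C g) :
  exists phi : forall s t : R, M t -> M s,
    [/\ unique (fun psi => local_flow psi /\ close_to_order mu eps psi) phi,
        limit_of_compositions mu phi,
        forall s t : R,
          (supdist (phi s t) (mu s t)
             <= (2 `^ (1 + eps) * g `|t - s| * (\sum_(i < n) C i)
                   * zeta (1 + eps) * `|t - s| `^ (1 + eps))%:E)%E
      & forall s t : R, (Lip (phi s t) <= (g `|t - s|)%:E)%E].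
Proof.
have [phi phi_limit] := dyadic_limit M_metric M_complete mu_aflow.
have phi_flow := limit_flow M_metric mu_aflow phi_limit.
have phi_close := limit_close_to_order mu_aflow phi_limit.
have gts0 s t := g_ge0 mu_aflow (normr_ge0 (t - s)).
exists phi; split.
- split=> // psi [psi_flow psi_close].
  exact: (near_flow_unique M_metric mu_aflow).
- exact: (flow_limit_of_compositions M_metric mu_aflow).
- move=> s t.
  have S0 := sum_C_ge0 mu_aflow; have eps0 := aflow_eps mu_aflow.
  have zeta0 : 0 <= zeta (1 + eps).
    by apply: le_trans (le_zeta eps0 0); rewrite /series /= big_geq.
  apply: uclose_supdist; first by rewrite !mulr_ge0 ?powR_ge0.
  have close := limit_close mu_aflow phi_limit.
  apply: uclose_le (close s t).
  rewrite !ler_wpM2r ?powR_ge0 // ler_peMl //.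
  apply: (@le_trans _ _ (1 `^ (1 + eps))); first by rewrite powR1.
  by rewrite ge0_ler_powR ?nnegrE ?ler1n // addr_ge0 // ltW.
- move=> s t; apply: expands_Lip => //.
  exact: (limit_expands M_metric mu_aflow phi_limit).
Qed.
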